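(* The biquadratic form in the real variables $\mathbf{x}=(x_1,x_2,x_3)$ and $\mathbf{y}=(y_1,y_2,y_3)$ $$P_{3,3,6}(\mathbf{x},\mathbf{y}) = x_1^2 y_1^2 + x_2^2 y_2^2 + x_3^2 y_3^2 + x_1^2 y_2^2 + x_2^2 y_3^2 + x_3^2 y_1^2$$ satisfies $\operatorname{sos}(P_{3,3,6}) = 6$.
   Context: An $m\times n$ biquadratic form is a real polynomial $P(\mathbf{x},\mathbf{y})=\sum_{i,k=1}^{m}\sum_{j,l=1}^{n} a_{ijkl}x_ix_ky_jy_l$ in variables $\mathbf{x}=(x_1,\dots,x_m)$, $\mathbf{y}=(y_1,\dots,y_n)$. A bilinear form is a polynomial $\sum_{i,j} c_{ij}x_iy_j$ with real coefficients. $P$ is SOS if it is a finite sum of squares of bilinear forms; its SOS rank $\operatorname{sos}(P)$ is the smallest number of squares of bilinear forms in such a representation. *)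

(* Defs.v *)
From mathcomp Require Import all_boot all_order all_algebra.
From mathcomp Require Import mpoly reals.

Set Implicit Arguments.
Unset Strict Implicit.
Unset Printing Implicit Defensive.

Import GRing.Theory.
Local Open Scope ring_scope.

(* Forms in x_1, ..., x_m and y_1, ..., y_n are polynomials in m + n variables,
   the x's coming first; indices start at 0. *)
Definition xvar (R : realType) (m n : nat) (i : 'I_m) : {mpoly R[m + n]} :=
  'X_(lshift n i).

Definition yvar (R : realType) (m n : nat) (j : 'I_n) : {mpoly R[m + n]} :=
  'X_(rshift m j).

Definition bilinear_form (R : realType) (m n : nat) (B : {mpoly R[m + n]}) : Prop :=
  exists c : 'I_m -> 'I_n -> R,
    B = \sum_(i < m) \sum_(j < n) c i j *: (xvar R n i * yvar R m j).

Definition biquadratic_form (R : realType) (m n : nat) (P : {mpoly R[m + n]}) : Prop :=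
  exists a : 'I_m -> 'I_n -> 'I_m -> 'I_n -> R,
    P = \sum_(i < m) \sum_(k < m) \sum_(j < n) \sum_(l < n)
          a i j k l *: (xvar R n i * xvar R n k * yvar R m j * yvar R m l).

Definition sum_of_squares (R : realType) (m n : nat) (P : {mpoly R[m + n]})
    (r : nat) : Prop :=
  exists B : 'I_r -> {mpoly R[m + n]},
    (forall t, bilinear_form (B t)) /\ P = \sum_(t < r) B t ^+ 2.

(* [sos_rank P r] is sos(P) = r; it holds for no r when P is not SOS. *)
Definition sos_rank (R : realType) (m n : nat) (P : {mpoly R[m + n]})
    (r : nat) : Prop :=
  sum_of_squares P r /\ (forall s : nat, sum_of_squares P s -> (r <= s)%N).

Definition P336 (R : realType) : {mpoly R[3 + 3]} :=
  let x1 := xvar R 3 (0 : 'I_3) in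
  let x2 := xvar R 3 (1 : 'I_3) in
  let x3 := xvar R 3 (2 : 'I_3) in
  let y1 := yvar R 3 (0 : 'I_3) in
  let y2 := yvar R 3 (1 : 'I_3) in
  let y3 := yvar R 3 (2 : 'I_3) in
  x1 ^+ 2 * y1 ^+ 2 + x2 ^+ 2 * y2 ^+ 2 + x3 ^+ 2 * y3 ^+ 2
  + x1 ^+ 2 * y2 ^+ 2 + x2 ^+ 2 * y3 ^+ 2 + x3 ^+ 2 * y1 ^+ 2.

Lemma biquadratic_formD (R : realType) (m n : nat) (P Q : {mpoly R[m + n]}) :
  biquadratic_form P -> biquadratic_form Q -> biquadratic_form (P + Q).
Proof.
move=> [a ->] [b ->]; exists (fun i j k l => a i j k l + b i j k l).
do 4! [rewrite -big_split /=; apply: eq_bigr => ? _].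
by rewrite scalerDl.
Qed.

Lemma biquadratic_form_sqr (R : realType) (m n : nat) (i : 'I_m) (j : 'I_n) :
  biquadratic_form (xvar R n i ^+ 2 * yvar R m j ^+ 2).
Proof.
exists (fun i' j' k l => [&& i' == i, j' == j, k == i & l == j]%:R).
rewrite (bigD1 i) //= (bigD1 i) //= (bigD1 j) //= (bigD1 j) //= !eqxx scale1r.
rewrite !big1 ?addr0 ?mulrA //.
- move=> i' /negPf ne; apply: big1 => k _; apply: big1 => j' _.
  by apply: big1 => l _; rewrite ne scale0r.
- move=> k /negPf ne; apply: big1 => j' _.
  by apply: big1 => l _; rewrite ne !andbF scale0r.
- by move=> j' /negPf ne; apply: big1 => l _; rewrite ne scale0r.
- by move=> l /negPf ne; rewrite ne scale0r.
Qed.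

Lemma P336_biquadratic (R : realType) : biquadratic_form (P336 R).
Proof.
by do 5! [apply: biquadratic_formD; last exact: biquadratic_form_sqr];
  apply: biquadratic_form_sqr.
Qed.

(* Main.v *)
Require Import Defs.
From mathcomp Require Import all_boot all_order all_algebra.
From mathcomp Require Import mpoly reals.
From mathcomp Require Import ring lra.

(** Read the monomials [x_i^2 y_j^2] of the form as the edges [(i, j)] of a
    bipartite graph [S]. The form is visibly a sum of [#|S|] squares, and the
    point is that no shorter representation exists when [S] has no 4-cycle; for
    [P336] the graph is a 6-cycle.

    Collect the values of the [s] bilinear forms of a representation in a vector
    [w x y] of [R^s]. It is bilinear in [(x, y)], its squared norm is the form,
    and the vectors [v_ij = w e_i e_j] determine it. Since the form has no
    mixed terms in [x], polarization gives [<w e_i y, w e_k y> = 0] for every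
    [y] and all [i != k]; likewise in [y]. Polarizing once more, in both
    arguments, only leaves [<v_ij, v_kl> + <v_il, v_kj> = 0]
    ([dot_values_exchange]). If [(i, j)] and [(k, l)] are edges then, as there
    is no 4-cycle, [(i, l)] or [(k, j)] is not an edge. The corresponding vector
    has norm 0, so it vanishes, and hence [v_ij] and [v_kl] are orthogonal. The
    [#|S|] vectors indexed by the edges are thus orthonormal in [R^s], which
    forces [#|S| <= s]. *)

Set Implicit Arguments.
Unset Strict Implicit.
Unset Printing Implicit Defensive.

Import Order.TTheory GRing.Theory Num.Theory.
Local Open Scope ring_scope.

Definition edge_form (R : realType) (m n : nat) (S : {set 'I_m * 'I_n}) :
    {mpoly R[m + n]} :=
  \sum_(e in S) xvar R n e.1 ^+ 2 * yvar R m e.2 ^+ 2.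

(** That is, [S] has no 4-cycle as a bipartite graph. *)
Definition rectangle_free (m n : nat) (S : {set 'I_m * 'I_n}) : Prop :=
  forall i k j l, i != k -> j != l ->
  (i, j) \in S -> (k, l) \in S -> ((i, l) \notin S) || ((k, j) \notin S).

Lemma bilinear_form_monomial (R : realType) (m n : nat) (i : 'I_m) (j : 'I_n) :
  bilinear_form (xvar R n i * yvar R m j).
Proof.
exists (fun i' j' => ((i' == i) && (j' == j))%:R).
rewrite (bigD1 i) //= (bigD1 j) //= !eqxx scale1r !big1 ?addr0 //.
- by move=> i' /negPf ne; apply: big1 => j' _; rewrite ne scale0r.
- by move=> j' /negPf ne; rewrite ne andbF scale0r.
Qed.

Lemma edge_form_sos (R : realType) (m n : nat) (S : {set 'I_m * 'I_n}) :
  sum_of_squares (edge_form R S) #|S|.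
Proof.
exists (fun t => xvar R n (enum_val t).1 * yvar R m (enum_val t).2); split.
  by move=> t; apply: bilinear_form_monomial.
rewrite /edge_form big_enum_val /=.
by apply: eq_bigr => t _; rewrite exprMn.
Qed.

Section DotProduct.
Variables (R : realType) (s : nat).
Implicit Types u v w : 'rV[R]_s.

Definition dot u v : R := \sum_t u 0 t * v 0 t.

Lemma dotC u v : dot u v = dot v u.
Proof. by apply: eq_bigr => t _; rewrite mulrC. Qed.

Lemma dotDl u v w : dot (u + v) w = dot u w + dot v w.
Proof. by rewrite -big_split; apply: eq_bigr => t _; rewrite mxE mulrDl. Qed.

Lemma dotDr u v w : dot u (v + w) = dot u v + dot u w.
Proof. by rewrite ![dot u _]dotC dotDl. Qed.

Lemma dot0l u : dot 0 u = 0.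
Proof. by apply: big1 => t _; rewrite mxE mul0r. Qed.

Lemma dot0r u : dot u 0 = 0.
Proof. by rewrite dotC dot0l. Qed.

Lemma dot_self_eq0 u : dot u u = 0 -> u = 0.
Proof.
move=> /eqP; rewrite psumr_eq0; last by move=> t _; rewrite -expr2 sqr_ge0.
move=> /allP u0; apply/rowP => t; rewrite mxE; apply/eqP.
by have := u0 t (mem_index_enum t); rewrite -expr2 sqrf_eq0.
Qed.

Lemma pythagoras_orthogonal u v :
  dot (u + v) (u + v) = dot u u + dot v v -> dot u v = 0.
Proof. by rewrite dotDl !dotDr (dotC v u); lra. Qed.

Lemma orthonormal_leq_dim r (v : 'I_r -> 'rV[R]_s) :
  (forall a b, dot (v a) (v b) = (a == b)%:R) -> (r <= s)%N.
Proof.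
move=> vP; pose M := \matrix_(a, t) v a 0 t.
apply: (@mulmx1_min _ _ _ M M^T); apply/matrixP => a b.
by rewrite !mxE -vP; apply: eq_bigr => t _; rewrite !mxE.
Qed.

End DotProduct.

Section Evaluation.
Variables (R : realType) (m n : nat).
Implicit Types (x : 'rV[R]_m) (y : 'rV[R]_n).

Definition eval_at x y (P : {mpoly R[m + n]}) : R := P.@[row_mx x y 0].

Lemma eval_at_xvar x y i : eval_at x y (xvar R n i) = x 0 i.
Proof. by rewrite /eval_at mevalXU row_mxEl. Qed.

Lemma eval_at_yvar x y j : eval_at x y (yvar R m j) = y 0 j.
Proof. by rewrite /eval_at mevalXU row_mxEr. Qed.

Lemma eval_at_bilinear (B : {mpoly R[m + n]}) : bilinear_form B ->
  exists c : 'M[R]_(m, n), forall x y, eval_at x y B = (x *m c *m y^T) 0 0.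
Proof.
move=> [c ->]; exists (\matrix_(i, j) c i j) => x y.
rewrite -mulmxA mxE /eval_at raddf_sum /=; apply: eq_bigr => i _.
rewrite mxE mulr_sumr raddf_sum /=; apply: eq_bigr => j _.
rewrite mevalZ mevalM -!/(eval_at _ _ _) eval_at_xvar eval_at_yvar !mxE; ring.
Qed.

Lemma eval_at_edge_form (S : {set 'I_m * 'I_n}) x y :
  eval_at x y (edge_form R S) = \sum_(e in S) x 0 e.1 ^+ 2 * y 0 e.2 ^+ 2.
Proof.
rewrite /eval_at raddf_sum /=; apply: eq_bigr => e _.
by rewrite mevalM !rmorphXn /= -!/(eval_at _ _ _) eval_at_xvar eval_at_yvar.
Qed.

End Evaluation.

Lemma sqr_delta_mxD (R : realType) (m : nat) (i k a : 'I_m) : i != k ->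
  ((delta_mx 0 i + delta_mx 0 k) : 'rV[R]_m) 0 a ^+ 2 =
  (delta_mx 0 i : 'rV[R]_m) 0 a ^+ 2 + (delta_mx 0 k : 'rV[R]_m) 0 a ^+ 2.
Proof.
move=> ik; rewrite !mxE !eqxx /=.
have [->|_] := eqVneq a i; last by rewrite expr0n !add0r.
by rewrite (negPf ik) expr0n !addr0.
Qed.

Section LowerBound.
Variables (R : realType) (m n : nat) (S : {set 'I_m * 'I_n}) (s : nat).
Variable B : 'I_s -> {mpoly R[m + n]}.
Hypothesis B_bilinear : forall t, bilinear_form (B t).
Hypothesis B_sos : edge_form R S = \sum_t B t ^+ 2.

Let w (x : 'rV[R]_m) (y : 'rV[R]_n) : 'rV[R]_s := \row_t eval_at x y (B t).
Let v i j := w (delta_mx 0 i) (delta_mx 0 j).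

Lemma valuesDl x x' y : w (x + x') y = w x y + w x' y.
Proof.
apply/rowP => t; rewrite !mxE.
by have [c cE] := eval_at_bilinear (B_bilinear t); rewrite !cE !mulmxDl mxE.
Qed.

Lemma valuesDr x y y' : w x (y + y') = w x y + w x y'.
Proof.
apply/rowP => t; rewrite !mxE.
have [c cE] := eval_at_bilinear (B_bilinear t).
by rewrite !cE linearD /= mulmxDr mxE.
Qed.

Lemma dot_values_self x y :
  dot (w x y) (w x y) = \sum_(e in S) x 0 e.1 ^+ 2 * y 0 e.2 ^+ 2.
Proof.
rewrite -eval_at_edge_form B_sos /eval_at raddf_sum /=.
by apply: eq_bigr => t _; rewrite !mxE rmorphXn /= expr2.
Qed.

Lemma dot_values_basis_self i j : dot (v i j) (v i j) = ((i, j) \in S)%:R.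
Proof.
rewrite dot_values_self.
transitivity (\sum_(e in S) (e == (i, j))%:R : R).
  apply: eq_bigr => -[a b] _; rewrite !mxE !eqxx /= xpair_eqE.
  by case: (a == i); case: (b == j); rewrite ?expr1n ?expr0n ?mul0r ?mulr0 ?mulr1.
have [ijS|ijS] := boolP (_ \in S).
  rewrite (bigD1 (i, j)) //= eqxx big1 ?addr0 // => e /andP[_ /negPf ne].
  by rewrite ne.
rewrite big1 // => e eS; case: eqP => // eij.
by rewrite -eij eS in ijS.
Qed.

(** The form has no term in [x_i x_k], so Pythagoras holds for the values at
    [e_i] and [e_k]. *)
Lemma dot_values_left i k y : i != k ->
  dot (w (delta_mx 0 i) y) (w (delta_mx 0 k) y) = 0.
Proof.
move=> ik; apply: pythagoras_orthogonal.
rewrite -valuesDl !dot_values_self -big_split /=.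
by apply: eq_bigr => e _; rewrite sqr_delta_mxD // mulrDl.
Qed.

Lemma dot_values_right x j l : j != l ->
  dot (w x (delta_mx 0 j)) (w x (delta_mx 0 l)) = 0.
Proof.
move=> jl; apply: pythagoras_orthogonal.
rewrite -valuesDr !dot_values_self -big_split /=.
by apply: eq_bigr => e _; rewrite sqr_delta_mxD // mulrDr.
Qed.

(** Polarization of [dot_values_left] in [y]: this is the vanishing of the
    coefficient of [x_i x_k y_j y_l]. *)
Lemma dot_values_exchange i k j l : i != k ->
  dot (v i j) (v k l) + dot (v i l) (v k j) = 0.
Proof.
move=> ik; have := dot_values_left (delta_mx 0 j + delta_mx 0 l) ik.
rewrite !valuesDr dotDl !dotDr -!/(v _ _).
by rewrite /v !(dot_values_left _ ik) add0r addr0.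
Qed.

Lemma edge_values_orthonormal : rectangle_free S ->
  {in S &, forall e f, dot (v e.1 e.2) (v f.1 f.2) = (e == f)%:R}.
Proof.
move=> rfS [i j] [k l] /= ijS klS; rewrite xpair_eqE.
have [<-|ik] := eqVneq i k.
  have [<-|jl] := eqVneq j l; first by rewrite dot_values_basis_self ijS.
  exact: dot_values_right.
have [<-|jl] := eqVneq j l; first exact: dot_values_left.
have v0 a b : (a, b) \notin S -> v a b = 0.
  by move=> /negPf abS; apply: dot_self_eq0; rewrite dot_values_basis_self abS.
have := dot_values_exchange j l ik.
by case/orP: (rfS i k j l ik jl ijS klS) => /v0 ->;
  rewrite ?dot0l ?dot0r addr0.
Qed.

Lemma edge_form_sos_length : rectangle_free S -> (#|S| <= s)%N.
Proof.
move=> rfS.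
apply: (@orthonormal_leq_dim R s _
  (fun a : 'I_#|S| => v (enum_val a).1 (enum_val a).2)) => a b.
by rewrite edge_values_orthonormal ?enum_valP // (inj_eq enum_val_inj).
Qed.

End LowerBound.

Lemma sos_rank_edge_form (R : realType) (m n : nat) (S : {set 'I_m * 'I_n}) :
  rectangle_free S -> sos_rank (edge_form R S) #|S|.
Proof.
move=> rfS; split; first exact: edge_form_sos.
by move=> s [B [B_bilinear B_sos]]; apply: (edge_form_sos_length B_bilinear B_sos).
Qed.

(** The graph of [P336]: each row [i] is joined to the columns [i] and
    [i + 1] modulo 3, which gives a 6-cycle. *)
Definition hexagon : {set 'I_3 * 'I_3} :=
  [set e | (e.2 == e.1) || (e.2 == e.1 + 1)].

Lemma sum_hexagon (V : nmodType) (F : 'I_3 * 'I_3 -> V) :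
  \sum_(e in hexagon) F e =
  F (0, 0) + F (1, 1) + F (2, 2) + F (0, 1) + F (1, 2) + F (2, 0).
Proof.
have -> : hexagon = [set:: [:: (0, 0); (1, 1); (2, 2); (0, 1); (1, 2); (2, 0)]].
  by apply/setP => -[[[|[|[|i]]] iP] [[|[|[|j]]] jP]]; rewrite !inE.
rewrite (eq_bigl _ _ (fun e => in_set _ e)) -big_uniq //=.
by rewrite !big_cons big_nil addr0 !addrA.
Qed.

Lemma card_hexagon : #|hexagon| = 6%N.
Proof. by rewrite -sum1_card sum_hexagon. Qed.

Lemma rectangle_free_hexagon : rectangle_free hexagon.
Proof.
by move=> [[|[|[|i]]] iP] [[|[|[|k]]] kP] [[|[|[|j]]] jP] [[|[|[|l]]] lP] //;
  rewrite !inE.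
Qed.

Lemma P336_edge_form (R : realType) : P336 R = edge_form R hexagon.
Proof. by rewrite /edge_form sum_hexagon. Qed.

Theorem theorem2p1 (R : realType) : sos_rank (P336 R) 6.
Proof.
rewrite P336_edge_form -card_hexagon.
exact: sos_rank_edge_form rectangle_free_hexagon.
Qed.
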